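(* Let $\mathcal{X}$ be a fuzzy random variable with values in $\mathcal{F}_c(\mathbb{R})$ such that $\mathrm{E}[\|\mathcal{X}_0\|]<\infty$. Then $\mathrm{Med}_1(\mathcal{X})=\mathrm{Med}_s(\mathcal{X})$; that is, a fuzzy set $U\in\mathcal{F}_c(\mathbb{R})$ minimizes $\mathrm{E}[\rho_1(U,\mathcal{X})]$ over $\mathcal{F}_c(\mathbb{R})$ if and only if $s_U(u,\alpha)$ is a median of the real random variable $s_{\mathcal{X}}(u,\alpha)$ for every $u\in\{-1,1\}$ and every $\alpha\in[0,1]$.
   Context: $\mathcal{F}_c(\mathbb{R})$ is the set of functions $A:\mathbb{R}\to[0,1]$ whose $\alpha$-levels $A_\alpha=\{x:A(x)\ge\alpha\}$ ($\alpha\in(0,1]$) and $A_0=\overline{\{x:A(x)>0\}}$ are non-empty compact intervals. Support function: $s_A(u,\alpha)=\sup\{uv:v\in A_\alpha\}$, $u\in\{-1,1\}$, $\alpha\in[0,1]$. A fuzzy random variable on $(\Omega,\mathcal{A},\mathbb{P})$ is a map $\mathcal{X}:\Omega\to\mathcal{F}_c(\mathbb{R})$ with each $\omega\mapsto\mathcal{X}(\omega)_\alpha$ a random compact set; $s_{\mathcal{X}}(u,\alpha)(\omega)=s_{\mathcal{X}(\omega)}(u,\alpha)$ is then a real random variable; $\|\mathcal{X}_0\|=\sup\{|x|:x\in\mathcal{X}(\cdot)_0\}$. $\rho_1(A,B)=\int_{\{-1,1\}}\int_0^1|s_A(u,\alpha)-s_B(u,\alpha)|\,d\alpha\,d\mathcal{V}(u)$,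 $\mathcal{V}$ uniform on $\{-1,1\}$. $\mathrm{Med}_1(\mathcal{X})=\arg\min_{U\in\mathcal{F}_c(\mathbb{R})}\mathrm{E}[\rho_1(U,\mathcal{X})]$. For a real random variable $X$, $\mathrm{Med}(X)$ is the set of all its medians. $\mathrm{Med}_s(\mathcal{X})$ (support medians) is the set of $A\in\mathcal{F}_c(\mathbb{R})$ with $s_A(u,\alpha)\in\mathrm{Med}(s_{\mathcal{X}}(u,\alpha))$ for all $u\in\{-1,1\}$, $\alpha\in[0,1]$. *)

(* Defs.v *)
From HB Require Import structures.
From mathcomp Require Import all_boot all_order all_algebra.
From mathcomp Require Import all_classical all_reals all_analysis.
Set Implicit Arguments. Unset Strict Implicit. Unset Printing Implicit Defensive.
Import Order.TTheory GRing.Theory Num.Theory.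
Import numFieldNormedType.Exports.
Local Open Scope classical_set_scope.
Local Open Scope ring_scope.

Section FuzzyDefs.
Context {R : realType}.

Definition level (A : R -> R) (a : R) : set R :=
  if a == 0 then closure [set x | 0 < A x] else [set x | a <= A x].

Definition ne_compact_interval (S : set R) : Prop :=
  exists a b : R, a <= b /\ S = `[a, b]%classic.

Definition Fc (A : R -> R) : Prop :=
  (forall x, 0 <= A x <= 1) /\
  (forall a, 0 <= a <= 1 -> ne_compact_interval (level A a)).

Definition supp_fun (A : R -> R) (u a : R) : R :=
  sup [set u * v | v in level A a].

(* rho_1 distance; V uniform on {-1,1} *)
Definition rho1 (A B : R -> R) : \bar R :=
  ((\int[@lebesgue_measure R]_(a in `[0%R, 1%R]%classic) `|supp_fun A 1 a - supp_fun B 1 a|%:E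
   + \int[@lebesgue_measure R]_(a in `[0%R, 1%R]%classic) `|supp_fun A (-1) a - supp_fun B (-1) a|%:E)
   * (2^-1)%:E)%E.

Context {d : measure_display} {T : measurableType d} (P : probability T R).

(* random compact set (Effros measurability) *)
Definition random_compact_set (F : T -> set R) : Prop :=
  (forall w, compact (F w) /\ F w !=set0) /\
  (forall K : set R, compact K -> measurable [set w | F w `&` K !=set0]).

Definition fuzzy_rv (X : T -> R -> R) : Prop :=
  (forall w, Fc (X w)) /\
  (forall a, 0 <= a <= 1 -> random_compact_set (fun w => level (X w) a)).

Definition norm0 (X : T -> R -> R) (w : T) : R :=
  sup [set `|x| | x in level (X w) 0].

Definition Med (Y : T -> R) : set R :=
  [set m : R | (P [set w | (Y w <= m)%R] >= (2^-1)%:E)%E /\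
           (P [set w | (m <= Y w)%R] >= (2^-1)%:E)%E].

Definition Med1 (X : T -> R -> R) : set (R -> R) :=
  [set U | Fc U /\ forall V, Fc V ->
     (\int[P]_w rho1 U (X w) <= \int[P]_w rho1 V (X w))%E].

Definition Meds (X : T -> R -> R) : set (R -> R) :=
  [set U | Fc U /\ forall u a, (u = -1 \/ u = 1) -> 0 <= a <= 1 ->
     Med (fun w => supp_fun (X w) u a) (supp_fun U u a)].

End FuzzyDefs.

(* Main.v *)
Require Import Defs.
From HB Require Import structures.
From mathcomp Require Import all_boot all_order all_algebra.
From mathcomp Require Import all_classical all_reals all_analysis.
From mathcomp Require Import measurable_realfun ring lra.
Import Order.TTheory GRing.Theory Num.Theory.
Import numFieldNormedType.Exports.
Local Open Scope classical_set_scope.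
Local Open Scope ring_scope.

(* By Tonelli, E[rho_1(V, X)] is half the sum over u of the integral over
   a in ]0, 1] of E|s_V(u, a) - s_X(u, a)|, and a median m of a real random
   variable Y is exactly a minimizer of E|m - Y|.  Hence support medians
   minimize.  Conversely the upper medians of s_X(u, a) are antitone and
   left-continuous in a, so they are the support function on ]0, 1] of some
   fuzzy set W.  A minimizer U does at least as well as W, so s_U(u, a) is a
   median for almost every a; since support functions are left-continuous on
   ]0, 1] and right-continuous at 0, and medians are closed under pointwise
   limits, it is a median for every a. *)

(** * Support functions of fuzzy sets: monotonicity, one-sided continuity and bounds *)

Lemma sup_max (R : realType) (S : set R) (m : R) :
  S m -> ubound S m -> sup S = m.
Proof.
move=> Sm ubm; apply/eqP; rewrite eq_le; apply/andP; split.
  by apply: ge_sup => //; exists m.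
by apply: ub_le_sup => //; exists m.
Qed.

Section SupportFunction.
Variable R : realType.
Implicit Types (A : R -> R) (u a b x v : R).

Lemma level_sub A a b : 0 <= a <= b -> level A b `<=` level A a.
Proof.
move=> /andP[a0 ab] v; rewrite /level.
case: (eqVneq a 0) => [a_eq0|an0]; case: (eqVneq b 0) => [b_eq0|bn0] //=.
- move=> bA; apply: subset_closure => /=; apply: lt_le_trans bA.
  by rewrite lt_neqAle eq_sym bn0 -a_eq0.
- by exfalso; move: an0; rewrite eq_le a0 -b_eq0 ab.
- exact: le_trans.
Qed.

(** Levels are compact intervals, so the supremum is attained, at the left endpoint for [u = -1] and
    at the right one for [u = 1]. Later proofs use only this characterization. *)
Lemma supp_funP A u a : Fc A -> u = -1 \/ u = 1 -> 0 <= a <= 1 ->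
  (exists2 v, level A a v & u * v = supp_fun A u a) /\
  (forall v, level A a v -> u * v <= supp_fun A u a).
Proof.
move=> FA hu a01; have [l [r [lr E]]] := FA.2 _ a01.
have [v lv vub] : exists2 v, level A a v & forall y, level A a y -> u * y <= u * v.
  case: hu => ->.
    exists l; first by rewrite E /= in_itv /= lexx lr.
    by move=> y; rewrite E /= in_itv /= => /andP[ly _]; rewrite !mulN1r lerN2.
  exists r; first by rewrite E /= in_itv /= lexx lr.
  by move=> y; rewrite E /= in_itv /= => /andP[_ yr]; rewrite !mul1r.
have -> : supp_fun A u a = u * v.
  by apply: sup_max => [|_ [y /= ly <-]]; [exists v | exact: vub].
by split => //; exists v.
Qed.

Lemma supp_fun_anti A u a b : Fc A -> u = -1 \/ u = 1 ->
  0 <= a -> a <= b -> b <= 1 -> supp_fun A u b <= supp_fun A u a.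
Proof.
move=> FA hu a0 ab b1.
have [|[v lv <-] _] := supp_funP A u b FA hu; first by rewrite (le_trans a0).
have [|_ ub] := supp_funP A u a FA hu; first by rewrite a0 (le_trans ab).
by apply: ub; apply: level_sub lv; rewrite a0.
Qed.

(** Left continuity, in the form suited to an antitone function. If [x] exceeded the support at [a],
    the point [u * x] would lie in all lower levels, hence in their intersection, the level at
    [a]. *)
Lemma supp_fun_left A u a x : Fc A -> u = -1 \/ u = 1 -> 0 < a <= 1 ->
  (forall b, 0 < b < a -> x <= supp_fun A u b) -> x <= supp_fun A u a.
Proof.
move=> FA hu /andP[a0 a1] H; rewrite leNgt; apply/negP => sx.
have uu : u * u = 1 by case: hu => ->; ring.
have [|[v lv vE] vub] := supp_funP A u a FA hu; first by rewrite ltW.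
(* [u * x] lies between [v], which belongs to the smaller level at [a], and the maximizer [w] at
   [b]; the level at [b] is an interval. *)
have lux b : 0 < b < a -> level A b (u * x).
  move=> /andP[b0 ba]; have b01 : 0 <= b <= 1 by rewrite ltW// ltW// (lt_le_trans ba).
  have [[w lw wE] _] := supp_funP A u b FA hu b01.
  have := H b; rewrite b0 ba => /(_ isT) xb.
  have : level A b v by apply: level_sub lv; rewrite !ltW.
  have [l [r [lr E]]] := FA.2 _ b01.
  move: lw; rewrite E /= !in_itv /= => /andP[lw wr] /andP[lv' vr].
  by case: hu xb sx vE wE => -> *; apply/andP; split; lra.
have : level A a (u * x).
  rewrite /level gt_eqF //= leNgt; apply/negP => Aa.
  pose b := (Num.max 0 (A (u * x)) + a) / 2.
  have m0 : 0 <= Num.max 0 (A (u * x)) by rewrite le_max lexx.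
  have ma : Num.max 0 (A (u * x)) < a by rewrite gt_max a0.
  have mA : A (u * x) <= Num.max 0 (A (u * x)) by rewrite le_max lexx orbT.
  have b0a : 0 < b < a by rewrite /b; apply/andP; split; lra.
  have := lux b b0a; rewrite /level gt_eqF /=; last by case/andP: b0a.
  by rewrite /b; lra.
by move/vub; rewrite mulrA uu mul1r leNgt sx.
Qed.

(** The half-line [u * y <= x] is closed, so it contains the closure defining level 0 once it
    contains every [y] with [0 < A y]; such a [y] lies in the level at [A y]. *)
Lemma supp_fun_right0 A u x : Fc A -> u = -1 \/ u = 1 ->
  (forall b, 0 < b <= 1 -> supp_fun A u b <= x) -> supp_fun A u 0 <= x.
Proof.
move=> FA hu H; have [|[v lv <-] _] := supp_funP A u 0 FA hu.
  by rewrite lexx ler01.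
have clS : closed [set y : R | u * y <= x].
  have -> : [set y : R | u * y <= x] = ( *%R u) @^-1` [set z | z <= x] by [].
  by apply: closed_comp; [move=> z _; exact: mulrl_continuous | exact: closed_le].
move: lv; rewrite /level eqxx /= => lv.
suff : closure [set y | 0 < A y] `<=` [set y : R | u * y <= x] by exact.
rewrite [X in _ `<=` X](closure_id _).1 //; apply: closure_subset => y /= Ay.
have Ay1 := FA.1 y; apply: le_trans (H (A y) _); last by rewrite Ay; case/andP: Ay1.
have [_ ub] := supp_funP A u (A y) FA hu Ay1.
by apply: ub; rewrite /level gt_eqF /=.
Qed.

(** The two allowed approaches are the sides on which continuity holds: from the left at a positive
    [a], from the right at 0. Monotonicity extends the estimate at a single [b] to all later
    terms. *)
Lemma supp_fun_cvg A u a (a_ : nat -> R) : Fc A -> u = -1 \/ u = 1 ->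
  0 <= a <= 1 -> (forall n, 0 < a_ n <= 1) -> (forall n, a_ n < a) \/ a = 0 ->
  a_ n @[n --> \oo] --> a ->
  supp_fun A u (a_ n) @[n --> \oo] --> supp_fun A u a.
Proof.
move=> FA hu /andP[a0 a1] a_01 a_a cva; apply/cvgrPdist_le => /= e e0.
case: a_a => [a_a|aE].
  have {}a0 : 0 < a by rewrite (lt_trans _ (a_a 0)) //; case/andP: (a_01 0).
  have [b /andP[b0 ba] sb] : exists2 b, 0 < b < a & supp_fun A u b < supp_fun A u a + e.
    apply: contrapT => nb; have : supp_fun A u a + e <= supp_fun A u a.
      apply: supp_fun_left => //; first by rewrite a0.
      by move=> b bI; rewrite leNgt; apply/negP => sb; apply: nb; exists b.
    by rewrite -subr_ge0; lra.
  near=> n.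
  have bn : b < a_ n by near: n; exact: cvgr_gt cva _ ba.
  have ana := a_a n.
  have h1 : supp_fun A u a <= supp_fun A u (a_ n).
    by apply: supp_fun_anti => //; apply: ltW => //; case/andP: (a_01 n).
  have h2 : supp_fun A u (a_ n) <= supp_fun A u b.
    by apply: supp_fun_anti => //; try exact: ltW; case/andP: (a_01 n).
  by rewrite ler_norml; apply/andP; split; lra.
have [b /andP[b0 b1] sb] : exists2 b, 0 < b <= 1 & supp_fun A u a - e < supp_fun A u b.
  apply: contrapT => nb; have : supp_fun A u a <= supp_fun A u a - e.
    rewrite {1}aE; apply: supp_fun_right0 => // b bI.
    by rewrite leNgt; apply/negP => sb; apply: nb; exists b.
  by lra.
near=> n.
have nb : a_ n < b by near: n; apply: cvgr_lt cva _ _; rewrite aE.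
have /andP[an0 an1] := a_01 n.
have h1 : supp_fun A u (a_ n) <= supp_fun A u a.
  by apply: supp_fun_anti => //; rewrite aE ltW.
have h2 : supp_fun A u b <= supp_fun A u (a_ n).
  by apply: supp_fun_anti => //; exact: ltW.
by rewrite ler_norml; apply/andP; split; lra.
Unshelve. all: by end_near.
Qed.

Lemma sup_norm_level0 A : Fc A ->
  sup [set `|x| | x in level A 0] = Num.max (supp_fun A 1 0) (supp_fun A (-1) 0).
Proof.
move=> FA; have h01 : 0 <= (0 : R) <= 1 by rewrite lexx ler01.
have [[v1 l1 <-] ub1] := supp_funP A 1 0 FA (or_intror erefl) h01.
have [[v2 l2 <-] ub2] := supp_funP A (-1) 0 FA (or_introl erefl) h01.
rewrite mul1r mulN1r; apply: sup_max.
  have h12 := ub2 _ l1; have h21 := ub1 _ l2.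
  (* [v1] and [v2] are the right and left endpoints; the largest modulus is reached at one of
     them. *)
  have [h|h] := leP v1 (- v2).
    by exists v2 => //; rewrite ler0_norm //; lra.
  by exists v1 => //; rewrite ger0_norm //; lra.
move=> _ [y ly <-]; have h1 := ub1 _ ly; have h2 := ub2 _ ly.
rewrite ler_norml le_max lerNl le_max; apply/andP; split; apply/orP.
  by right; lra.
by left; lra.
Qed.

(** All levels lie inside level 0. For [X w] the bound is [norm0 X w], which provides the domination
    uniform in [a]. *)
Lemma normr_supp_fun A u a : Fc A -> u = -1 \/ u = 1 -> 0 <= a <= 1 ->
  `|supp_fun A u a| <= Num.max (supp_fun A 1 0) (supp_fun A (-1) 0).
Proof.
move=> FA hu a01; have h01 : 0 <= (0 : R) <= 1 by rewrite lexx ler01.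
have [[v lv <-] _] := supp_funP A u a FA hu a01.
have l0v : level A 0 v by apply: level_sub lv; rewrite lexx; case/andP: a01.
have -> : `|u * v| = `|v| by case: hu => ->; rewrite ?mul1r ?mulN1r ?normrN.
rewrite -sup_norm_level0 //; apply: ub_le_sup; last by exists v.
have [l [r [lr E]]] := FA.2 _ h01; exists (Num.max `|l| `|r|) => _ [y + <-].
rewrite E /= in_itv /= => /andP[ly yr].
by have [y0|y0] := leP 0 y; rewrite le_max; apply/orP; [right|left];
  rewrite ?(ger0_norm y0) ?(ltr0_norm y0) ?(ger0_norm (le_trans y0 yr)) //
  ltr0_norm ?lerN2 // (le_lt_trans ly).
Qed.

End SupportFunction.

(** * Construction of a fuzzy set from its support function *)

Lemma closure_inf (R : realType) (S : set R) :
  S !=set0 -> has_lbound S -> closure S (inf S).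
Proof.
move=> S0 Slb B /nbhs_ballP[e /= e0 eB].
have [x Sx xe] := inf_adherent e0 (conj S0 Slb).
have lx : inf S <= x by exact: ge_inf.
by exists x; split => //; apply: eB; rewrite /ball /= ler0_norm; lra.
Qed.

Lemma closure_is_interval (R : realType) (S : set R) :
  S !=set0 -> has_lbound S -> has_ubound S -> is_interval S ->
  ne_compact_interval (closure S).
Proof.
move=> S0 Slb Sub iS.
have sub : closure S `<=` `[inf S, sup S]%classic.
  rewrite [X in _ `<=` X](closure_id _).1; last exact: itv_closed.
  apply: closure_subset => x Sx /=.
  by rewrite in_itv /= ge_inf //= ub_le_sup.
have cp : closure S (inf S) by exact: closure_inf.
have cq : closure S (sup S) by exact: closure_sup.
(* Intervals are the connected subsets of the line, and connectedness passes to closures. *)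
have iC : is_interval (closure S).
  by apply/connected_intervalP/connected_closure/connected_intervalP.
exists (inf S), (sup S); split.
  by have := sub _ cp; rewrite /= in_itv /= lexx.
apply/seteqP; split => // x /=; rewrite in_itv /=; exact: iC.
Qed.

(* [U x] is the largest [a] with [- g (-1) a <= x <= g 1 a]; the second
   hypothesis is left continuity of [g u], and nothing is claimed at [a = 0],
   where the support of [U] is the right limit of [g]. *)
Lemma Fc_of_supp_fun (R : realType) (g : R -> R -> R) :
  (forall u a b : R, u = -1 \/ u = 1 -> 0 <= a -> a <= b -> b <= 1 ->
    g u b <= g u a) ->
  (forall u a x : R, u = -1 \/ u = 1 -> 0 < a <= 1 ->
    (forall b : R, 0 < b < a -> x <= g u b) -> x <= g u a) ->
  (forall a : R, 0 < a <= 1 -> 0 <= g 1 a + g (-1) a) ->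
  exists U, Fc U /\
    forall u a, u = -1 \/ u = 1 -> 0 < a <= 1 -> supp_fun U u a = g u a.
Proof.
move=> anti left ge0; have h1 : (1 : R) = -1 \/ (1 : R) = 1 by right.
have hN : (-1 : R) = -1 \/ (-1 : R) = 1 by left.
(* The value 0 is always included, so [S x] is never empty and [U x] is 0 at points outside every
   positive level. *)
pose S (x : R) : set R := [set a | a = 0 \/ 0 < a <= 1 /\ - g (-1) a <= x <= g 1 a].
pose U (x : R) := sup (S x).
have S1 x : ubound (S x) 1 by move=> a [->|[/andP[]]//]; rewrite ler01.
have SU x a : S x a -> a <= U x by move=> ?; apply: ub_le_sup => //; exists 1.
have U01 x : 0 <= U x <= 1.
  by rewrite SU /=; [apply: ge_sup => //; exists 0 |]; left.
have lE (a : R) : 0 < a <= 1 -> level U a = `[- g (-1) a, g 1 a]%classic.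
  move=> a01; have /andP[a0 a1] := a01; rewrite /level gt_eqF //.
  apply/seteqP; split => x /=; rewrite in_itv /=; last by move=> ?; apply: SU; right.
  (* Some [c] in [S x] exceeds [b], and monotonicity carries its bounds down to [b]; left continuity
     then reaches [a] itself. *)
  move=> aU; have K b : 0 < b < a -> - g (-1) b <= x <= g 1 b.
    move=> /andP[b0 ba].
    have [c Sc bc] : exists2 c, S x c & b < c.
      by apply: sup_gt; [exists 0; left | exact: lt_le_trans aU].
    case: Sc bc => [->|[/andP[c0 c1] /andP[c2 c3]] bc]; first by rewrite ltNge ltW.
    have hg u : u = -1 \/ u = 1 -> g u c <= g u b by move=> ?; apply: anti => //; exact: ltW.
    by have := hg _ h1; have := hg _ hN => ? ?; apply/andP; split; lra.
  apply/andP; split; first rewrite lerNl; apply: left => // b /K/andP[] //.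
  by rewrite lerNl.
have level_pos x : 0 < U x -> - g (-1) (U x) <= x <= g 1 (U x).
  move=> Ux; have := U01 x => /andP[_ U1].
  have : level U (U x) x by rewrite /level gt_eqF //=.
  by rewrite lE ?Ux //= in_itv.
have FU : Fc U.
  split => // a /andP[a0 a1]; have [->|an0] := eqVneq a 0; last first.
    have {}a0 : 0 < a by rewrite lt_neqAle eq_sym an0.
    exists (- g (-1) a), (g 1 a); split; last by rewrite lE ?a0.
    by have := ge0 a; rewrite a0 a1 => /(_ isT); lra.
  rewrite /level eqxx; have anti0 u x : u = -1 \/ u = 1 -> g u (U x) <= g u 0.
    by move=> hu; have /andP[? ?] := U01 x; exact: anti.
  apply: closure_is_interval.
  - have h01 : 0 < (1 : R) <= 1 by rewrite ltr01 lexx.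
    exists (g 1 1); apply: (@lt_le_trans _ _ 1) => //.
    have : level U 1 (g 1 1).
      by rewrite lE //= in_itv /= lexx andbT; have := ge0 1 h01; lra.
    by rewrite /level oner_eq0.
  - exists (- g (-1) 0) => x /= /level_pos/andP[+ _]; apply: le_trans.
    by rewrite lerN2; exact: anti0.
  - by exists (g 1 0) => x /= /level_pos/andP[_ /le_trans]; apply; exact: anti0.
  - move=> x y /= Ux Uy z /andP[xz zy].
    (* Both points belong to the level at [e], an interval, so [z] does too and [U z] is at least
       [e]. *)
    pose e := Num.min (U x) (U y).
    have e0 : 0 < e by rewrite lt_min Ux.
    have e01 : 0 < e <= 1 by rewrite e0 ge_min; have /andP[_ ->] := U01 x.
    have L w : e <= U w -> - g (-1) e <= w <= g 1 e.
      move=> ew; have : level U e w by rewrite /level gt_eqF.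
      by rewrite lE //= in_itv.
    have /andP[x1 _] : - g (-1) e <= x <= g 1 e by apply: L; rewrite ge_min lexx.
    have /andP[_ y2] : - g (-1) e <= y <= g 1 e by apply: L; rewrite ge_min lexx orbT.
    have : level U e z by rewrite lE //= in_itv /=; apply/andP; split; lra.
    by rewrite /level gt_eqF //=; exact: lt_le_trans.
exists U; split => // u a hu a01.
have a01' : 0 <= a <= 1 by case/andP: a01 => ? ->; rewrite ltW.
have [[v lv <-] ub] := supp_funP _ U u a FU hu a01'.
have g0 := ge0 a a01.
case: hu lv ub => -> + ub; rewrite lE //= in_itv /= => /andP[lv vr];
  apply/eqP; rewrite eq_le; apply/andP; split; try lra.
  have := ub (- g (-1) a); rewrite lE //= in_itv /= lexx /=.
  by move=> /(_ ltac:(lra)); lra.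
have := ub (g 1 a); rewrite lE //= in_itv /= lexx /= andbT.
by move=> /(_ ltac:(lra)); lra.
Qed.

(** Supplies sequences tending to [c] strictly from one side, chosen by the sign of [k]. *)
Lemma cvg_affine_harmonic (R : realType) (c k : R) :
  c + k * harmonic n @[n --> \oo] --> c.
Proof.
rewrite -[X in _ --> X]addr0 -[X in _ --> _ + X](mulr0 k).
apply: cvgD; first exact: cvg_cst.
by apply: cvgM; [exact: cvg_cst | exact: cvg_harmonic].
Qed.

(** * Medians of real random variables as minimizers of the mean absolute deviation *)

Section Medians.
Context {R : realType} {d : measure_display} {T : measurableType d}.
Variable P : probability T R.
Implicit Types (Y : T -> R) (c m t x : R).

Lemma measurable_le_set (f g : T -> R) :
  measurable_fun setT f -> measurable_fun setT g ->
  measurable [set w | f w <= g w].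
Proof.
move=> mf mg; have := measurable_fun_ler mf mg measurableT (I : measurable [set true]).
by rewrite setTI preimage_true.
Qed.

Lemma measurable_lt_set (f g : T -> R) :
  measurable_fun setT f -> measurable_fun setT g ->
  measurable [set w | f w < g w].
Proof.
move=> mf mg; have := measurable_fun_ltr mf mg measurableT (I : measurable [set true]).
by rewrite setTI preimage_true.
Qed.

(** If [m < Y w], then [m_ n < Y_ n w] eventually. Hence the limit superior of the events lies in
    the limit event, and continuity from above on the decreasing tail unions [F n] keeps the bound
    [p]. *)
Lemma probability_le_cvg (p : \bar R) (Y_ : nat -> T -> R) Y (m_ : nat -> R) m :
  (forall n, measurable_fun setT (Y_ n)) -> measurable_fun setT Y ->
  (forall w, Y_ n w @[n --> \oo] --> Y w) -> m_ n @[n --> \oo] --> m ->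
  (forall n, (p <= P [set w | (Y_ n w <= m_ n)%R])%E) ->
  (p <= P [set w | (Y w <= m)%R])%E.
Proof.
move=> mY_ mY cY cm H.
have mE k : measurable [set w | Y_ k w <= m_ k] by exact: measurable_le_set.
pose F n := \bigcup_(k in [set k | (n <= k)%N]) [set w | Y_ k w <= m_ k].
have mF n : measurable (F n) by exact: bigcup_measurable.
have mI : measurable (\bigcap_n F n) by exact: bigcapT_measurable.
have cF : (P \o F) n @[n --> \oo] --> P (\bigcap_n F n).
  apply: nonincreasing_cvg_mu => //.
    by rewrite (le_lt_trans (probability_le1 _ _)) // ltry.
  move=> i j ij; apply/subsetPset => w [k /= jk Yk]; exists k => //=.
  exact: leq_trans jk.
have pI : (p <= P (\bigcap_n F n))%E.
  rewrite -(cvg_lim _ cF) //; apply: lime_ge; first by apply/cvg_ex; eexists; exact: cF.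
  apply: nearW => n /=; apply: le_trans (H n) _.
  by apply: le_measure; rewrite ?inE // => w Yw; exists n => /=.
apply: le_trans pI _; apply: le_measure; rewrite ?inE //; first exact: measurable_le_set.
move=> w Fw /=; rewrite leNgt; apply/negP => mYw.
have [N _ NE] : \forall n \near \oo, m_ n < Y_ n w.
  pose e := (Y w + m) / 2.
  near=> n; apply: (@lt_trans _ _ e); near: n.
    by apply: cvgr_lt cm _ _; rewrite /e; lra.
  by apply: cvgr_gt (cY w) _ _; rewrite /e; lra.
have [k /= Nk] := Fw N I; apply/negP; rewrite -ltNge; exact: NE.
Unshelve. all: by end_near.
Qed.

(** Reflection exchanges the two median inequalities, so later arguments treat one side only. *)
Lemma MedN Y m : Med P Y m <-> Med P (\- Y) (- m).
Proof.
have E1 : [set w | (\- Y) w <= - m] = [set w | m <= Y w].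
  by apply/seteqP; split => w /=; rewrite lerN2.
have E2 : [set w | - m <= (\- Y) w] = [set w | Y w <= m].
  by apply/seteqP; split => w /=; rewrite lerN2.
by rewrite /Med /= E1 E2; split => -[].
Qed.

Lemma probability_ge_cvg (p : \bar R) (Y_ : nat -> T -> R) Y (m_ : nat -> R) m :
  (forall n, measurable_fun setT (Y_ n)) -> measurable_fun setT Y ->
  (forall w, Y_ n w @[n --> \oo] --> Y w) -> m_ n @[n --> \oo] --> m ->
  (forall n, (p <= P [set w | (m_ n <= Y_ n w)%R])%E) ->
  (p <= P [set w | (m <= Y w)%R])%E.
Proof.
move=> mY_ mY cY cm H.
have -> : [set w | m <= Y w] = [set w | - Y w <= - m].
  by apply/seteqP; split => w /=; rewrite lerN2.
apply: (@probability_le_cvg _ (fun n => \- Y_ n) (\- Y) (fun n => - m_ n)).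
- by move=> n; exact: measurable_funN.
- exact: measurable_funN.
- by move=> w; exact: cvgN.
- exact: cvgN.
- move=> n; rewrite [X in P X](_ : _ = [set w | m_ n <= Y_ n w]) //.
  by apply/seteqP; split => w /=; rewrite lerN2.
Qed.

Lemma Med_cvg (Y_ : nat -> T -> R) Y (m_ : nat -> R) m :
  (forall n, measurable_fun setT (Y_ n)) -> measurable_fun setT Y ->
  (forall w, Y_ n w @[n --> \oo] --> Y w) -> m_ n @[n --> \oo] --> m ->
  (forall n, Med P (Y_ n) (m_ n)) -> Med P Y m.
Proof.
move=> mY_ mY cY cm H; split.
  by apply: (@probability_le_cvg _ Y_ _ m_) => // n; case: (H n).
by apply: (@probability_ge_cvg _ Y_ _ m_) => // n; case: (H n).
Qed.

(** Subadditivity gives [1 <= P A + P B]. *)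
Lemma half_lt_of_cover (A B : set T) : measurable A -> measurable B ->
  A `|` B = setT -> ~~ ((2^-1)%:E <= P A)%E -> ((2^-1)%:E < P B)%E.
Proof.
move=> mA mB AB; rewrite -ltNge => hA.
have h1 : (1 <= P A + P B)%E.
  rewrite -(@probability_setT _ _ _ P) -AB; exact: measureU2.
have fA : P A \is a fin_num by exact: fin_num_measure.
have fB : P B \is a fin_num by exact: fin_num_measure.
move: h1 hA; rewrite -(fineK fA) -(fineK fB) -EFinD lee_fin !lte_fin.
by move: (fine _) (fine _) => a b; lra.
Qed.


(* Otherwise [Y / (n + 1) <= -1] has probability at least 1/2 for every [n],
   while [Y / (n + 1)] tends to 0. *)
Lemma not_le_tail Y : measurable_fun setT Y ->
  ~ (forall x, ((2^-1)%:E <= P [set w | (Y w <= x)%R])%E).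
Proof.
move=> mY H; have : ((2^-1)%:E <= P [set _ : T | (0 <= -1 :> R)%R])%E.
  apply: (@probability_le_cvg _ (fun n w => Y w * harmonic n) (cst 0)
    (fun n => -1)) => //.
  - by move=> n; apply: measurable_funM => //; exact: measurable_cst.
  - by move=> w; rewrite -[X in _ --> X](mulr0 (Y w)); apply: cvgM;
      [exact: cvg_cst | exact: cvg_harmonic].
  - exact: cvg_cst.
  - move=> n; rewrite [X in P X](_ : _ = [set w | Y w <= - n.+1%:R]) //.
    by apply/seteqP; split => w /=; rewrite ler_pdivrMr // mulN1r.
rewrite [X in P X](_ : _ = set0) ?measure0 ?lee_fin.
  by apply/negP; rewrite -ltNge invr_gt0.
by apply/seteqP; split => // w /=; lra.
Qed.

(** The set [E] is closed downwards, non-empty and bounded above because neither [Y] nor [- Y] has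
    all its lower tails of mass at least 1/2; it contains its supremum by passage to the limit. The
    equivalence turns inequalities between upper medians into inequalities between probabilities. *)
Lemma upper_median Y : measurable_fun setT Y ->
  exists g, Med P Y g /\
    forall x, ((2^-1)%:E <= P [set w | (x <= Y w)%R])%E <-> x <= g.
Proof.
move=> mY.
have mle c : measurable [set w | Y w <= c] by exact: measurable_le_set.
have mge c : measurable [set w | c <= Y w] by exact: measurable_le_set.
pose E := [set x | ((2^-1)%:E <= P [set w | (x <= Y w)%R])%E].
have down x y : x <= y -> E y -> E x.
  move=> xy; rewrite /E /= => /le_trans; apply.
  by apply: le_measure; rewrite ?inE // => w /=; exact: le_trans.
have comp x : ~ E x -> ((2^-1)%:E <= P [set w | (Y w <= x)%R])%E.
  move=> /negP Ex; apply/ltW; move: Ex; apply: half_lt_of_cover => //.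
  by apply/seteqP; split => // w _ /=; have [|/ltW] := leP x (Y w); [left|right].
have E0 : E !=set0.
  apply: contrapT => nE; apply: (not_le_tail Y mY) => x; apply: comp => Ex.
  by apply: nE; exists x.
have Eub : has_ubound E.
  apply: contrapT => nE; apply: (not_le_tail (\- Y)); first exact: measurable_funN.
  move=> x; have [y Ey xy] : exists2 y, E y & - x < y.
    apply: contrapT => nxy; apply: nE; exists (- x) => y Ey.
    by rewrite leNgt; apply/negP => xy; apply: nxy; exists y.
  rewrite [X in P X](_ : _ = [set w | - x <= Y w]); first exact: down (ltW xy) Ey.
  by apply/seteqP; split => w /=; rewrite lerNl.
have Elt x : x < sup E -> E x.
  by move=> xE; have [y Ey /ltW xy] := sup_gt E0 xE; exact: down xy Ey.
have Esup : E (sup E).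
  apply: (@probability_ge_cvg _ (fun=> Y) _ (fun n => sup E + (-1) * harmonic n)) => //.
  - by move=> w; exact: cvg_cst.
  - exact: cvg_affine_harmonic.
  - by move=> n; apply: Elt; rewrite gtrDl mulN1r oppr_lt0 invr_gt0.
exists (sup E); split; last first.
  move=> x; split => [Ex|xE]; first exact: ub_le_sup.
  exact: down xE Esup.
split => //.
(* Points strictly above [sup E] are outside [E], so the other inequality holds at them and passes
   to the limit. *)
apply: (@probability_le_cvg _ (fun=> Y) _ (fun n => sup E + 1 * harmonic n)) => //.
- by move=> w; exact: cvg_cst.
- exact: cvg_affine_harmonic.
- move=> n; apply: comp => En; have := ub_le_sup Eub En.
  by apply/negP; rewrite -ltNge ltrDl mul1r invr_gt0.
Qed.

Local Notation dev Y c := (\int[P]_w `|c - Y w|%:E)%E.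

Lemma measurable_dev Y c : measurable_fun setT Y ->
  measurable_fun setT (fun w => `|c - Y w|%:E).
Proof.
move=> mY; apply/measurable_EFinP; apply: measurableT_comp => //.
by apply: measurable_funB => //; exact: measurable_cst.
Qed.

(* Integrates [|t - y| + (c - t) 1_(y <= t) <= |c - y| + (c - t) 1_(t < y)]. *)
Lemma dev_shift Y t c : measurable_fun setT Y -> t <= c ->
  (dev Y t + (c - t)%:E * P [set w | (Y w <= t)%R] <=
   dev Y c + (c - t)%:E * P [set w | (t < Y w)%R])%E.
Proof.
move=> mY tc; have tc0 : 0 <= c - t by rewrite subr_ge0.
have mA : measurable [set w | Y w <= t] by exact: measurable_le_set.
have mB : measurable [set w | t < Y w] by exact: measurable_lt_set.
have E A a : measurable A -> (dev Y a + (c - t)%:E * P A =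
    \int[P]_w (`|a - Y w|%:E + ((c - t) * \1_A w)%:E))%E.
  move=> mA'; rewrite ge0_integralD //=.
  - congr (_ + _)%E; under eq_integral do rewrite EFinM.
    rewrite ge0_integralZl //= ?integral_indic ?setIT //.
    + by apply/measurable_EFinP.
  - exact: measurable_dev.
  - by move=> w _; rewrite lee_fin mulr_ge0.
  - apply/measurable_EFinP; apply: measurable_funM => //; exact: measurable_cst.
rewrite !E //; apply: ge0_le_integral => //.
- by move=> w _; rewrite lee_fin addr_ge0 // mulr_ge0.
- apply: emeasurable_funD; first exact: measurable_dev.
  by apply/measurable_EFinP; apply: measurable_funM => //; exact: measurable_cst.
- apply: emeasurable_funD; first exact: measurable_dev.
  by apply/measurable_EFinP; apply: measurable_funM => //; exact: measurable_cst.
- move=> w _; rewrite lee_fin !indicE.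
  have [Yt|Yt] := leP (Y w) t.
    rewrite mem_set // memNset /=; last by apply/negP; rewrite -leNgt.
    by rewrite !ger0_norm; lra.
  rewrite memNset /=; last by apply/negP; rewrite -ltNge.
  rewrite mem_set // [`|t - _|]ltr0_norm; last by lra.
  rewrite /=; have := ler_norm (c - Y w); have := ler_norm (- (c - Y w)).
  by rewrite normrN; lra.
Qed.

Lemma devN Y c : dev (\- Y) (- c) = dev Y c.
Proof. by apply: eq_integral => w _; rewrite opprK addrC distrC. Qed.


(** With [p] the probability of [Y <= t], the complement has probability [1 - p], and collecting
    terms gives [2 * p - 1], a lower bound for the slope of the deviation between [t] and [c]. *)
Lemma dev_shift_fine Y t c : measurable_fun setT Y -> t <= c ->
  (dev Y t + ((c - t) * (2 * fine (P [set w | (Y w <= t)%R]) - 1))%:E <=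
   dev Y c)%E.
Proof.
move=> mY tc; have := dev_shift Y t c mY tc.
have mA : measurable [set w | Y w <= t] by exact: measurable_le_set.
have -> : [set w | t < Y w] = ~` [set w | Y w <= t].
  by apply/seteqP; split => w /=; rewrite ltNge => /negP.
have fA : P [set w | Y w <= t] \is a fin_num by exact: fin_num_measure.
rewrite probability_setC // -{1 2}(fineK fA); move: (fine _) => p.
rewrite -EFinB -!EFinM -leeBlDr // -addeA -EFinB.
by rewrite (_ : _ - _ = (c - t) * (2 * p - 1)) //; ring.
Qed.

Lemma Med_dev_le Y m c : measurable_fun setT Y -> Med P Y m ->
  (dev Y m <= dev Y c)%E.
Proof.
wlog mc : Y m c / m <= c.
  move=> H; have [|/ltW cm mY MY] := leP m c; first exact: H.
  rewrite -devN -(devN Y c); apply: H; first by rewrite lerN2.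
    exact: measurable_funN.
  by rewrite -MedN.
move=> mY [hm _]; have mA : measurable [set w | Y w <= m] by exact: measurable_le_set.
have fA : P [set w | Y w <= m] \is a fin_num by exact: fin_num_measure.
apply: le_trans (dev_shift_fine Y m c mY mc); rewrite leeDl // lee_fin.
move: hm; rewrite -{1}(fineK fA) lee_fin; move: (fine _) => p hp.
by apply: mulr_ge0; lra.
Qed.

(* If [m < c] and [P (c <= Y) < 1/2], then already [P (t <= Y) < 1/2] for some
   [t] in ]m, c[, and moving from [c] down to [t] strictly improves. *)
Lemma Med_of_dev_le Y m c : measurable_fun setT Y -> Med P Y m ->
  (dev Y m < +oo)%E -> (dev Y c <= dev Y m)%E -> Med P Y c.
Proof.
move=> + + + +; suff half Y' m' c' : measurable_fun setT Y' -> Med P Y' m' ->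
    (dev Y' m' < +oo)%E -> (dev Y' c' <= dev Y' m')%E ->
    ((2^-1)%:E <= P [set w | (c' <= Y' w)%R])%E.
  move=> mY MY fin le; split; last exact: half MY fin le.
  rewrite [X in P X](_ : _ = [set w | - c <= (\- Y) w]).
    by apply: (half (\- Y) (- m)); rewrite ?devN // -?MedN //; exact: measurable_funN.
  by apply/seteqP; split => w /=; rewrite lerN2.
clear Y m c; move: Y' m' c' => Y m c mY MY fin le.
have mge x : measurable [set w | x <= Y w] by exact: measurable_le_set.
have mle x : measurable [set w | Y w <= x] by exact: measurable_le_set.
have [cm|mc] := leP c m.
  apply: le_trans MY.2 _; apply: le_measure; rewrite ?inE // => w /=.
  exact: le_trans.
have above t : m < t -> t < c -> ((2^-1)%:E <= P [set w | (t <= Y w)%R])%E.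
  move=> mt tc; apply: contrapT => /negP nt.
  have h : ((2^-1)%:E < P [set w | (Y w <= t)%R])%E.
    move: nt; apply: half_lt_of_cover => //.
    by apply/seteqP; split => // w _ /=; have [|/ltW] := leP t (Y w); [left|right].
  have := dev_shift_fine Y t c mY (ltW tc).
  have fA : P [set w | Y w <= t] \is a fin_num by exact: fin_num_measure.
  move: h; rewrite -{1}(fineK fA) lte_fin; move: (fine _) => p hp h.
  (* Finiteness permits cancelling [dev Y t] below, where the strictly positive gain contradicts the
     minimality of [dev Y m]. *)
  have ft : dev Y t \is a fin_num.
    rewrite ge0_fin_numE; last exact: integral_ge0.
    apply: le_lt_trans fin; apply: le_trans le; apply: le_trans h; rewrite leeDl // lee_fin.
    by apply: mulr_ge0; lra.
  have : (dev Y t + ((c - t) * (2 * p - 1))%:E <= dev Y t)%E.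
    apply: le_trans h _; apply: le_trans le _; exact: Med_dev_le.
  rewrite -{1 2}(fineK ft) -EFinD lee_fin gerDl leNgt => /negP; apply.
  by apply: mulr_gt0; lra.
(* Since [harmonic n <= 1], this slope keeps the sequence strictly between [m] and [c]. *)
pose k := (m - c) / 2.
apply: (@probability_ge_cvg _ (fun=> Y) _ (fun n => c + k * harmonic n)) => //.
- by move=> w; exact: cvg_cst.
- exact: cvg_affine_harmonic.
- move=> n; have h0 : 0 < harmonic n :> R by rewrite invr_gt0.
  have h1 : harmonic n <= 1 :> R by rewrite invf_le1 // ler1n.
  by apply: above; rewrite /k; nra.
Qed.

End Medians.

(** * Tonelli's theorem with the second variable restricted to a measurable set *)

Section Tonelli.
Context {R : realType} {d1 d2 : measure_display}.
Context {T1 : measurableType d1} {T2 : measurableType d2}.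
Variables (m1 : {sigma_finite_measure set T1 -> \bar R})
  (m2 : {sigma_finite_measure set T2 -> \bar R}) (D : set T2).
Variable f : T1 * T2 -> \bar R.
Hypotheses (mD : measurable D) (mf : measurable_fun (setT `*` D) f).
Hypothesis f0 : forall z, (0 <= f z)%E.

(** Measurability of [f] is assumed only over [D]; extension by zero reduces everything to the full
    product. *)
Let g := f \_ (setT `*` D).

Let mg : measurable_fun setT g.
Proof. by apply/(measurable_restrictT _ _).1 => //; exact: measurableX. Qed.

Let g0 z : (0 <= g z)%E.
Proof. by rewrite /g patchE; case: ifP. Qed.

Let gE x : (fun y => g (x, y)) = (fun y => f (x, y)) \_ D.
Proof.
apply/funext => y; rewrite /g !patchE.
congr (if _ then _ else _).
by apply/idP/idP; rewrite !inE //= => -[].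
Qed.

Let GE : (fun y => \int[m1]_x g (x, y))%E =
  (fun y => \int[m1]_x f (x, y))%E \_ D.
Proof.
apply/funext => y; rewrite patchE; case: ifP => yD.
  by apply: eq_integral => x _; rewrite [g _](congr1 (@^~ y) (gE x)) patchE yD.
by apply: integral0_eq => x _; rewrite [g _](congr1 (@^~ y) (gE x)) patchE yD.
Qed.

Lemma measurable_fun_tonelli_in1 :
  measurable_fun setT (fun x => \int[m2]_(y in D) f (x, y))%E.
Proof.
under eq_fun do rewrite integral_mkcond -gE.
exact: measurable_fun_fubini_tonelli_F.
Qed.

Lemma measurable_fun_tonelli_in2 :
  measurable_fun D (fun y => \int[m1]_x f (x, y))%E.
Proof.
apply/(measurable_restrictT _ mD).2; rewrite -GE.
exact: measurable_fun_fubini_tonelli_G.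
Qed.

Lemma fubini_tonelli_in :
  (\int[m1]_x \int[m2]_(y in D) f (x, y) =
   \int[m2]_(y in D) \int[m1]_x f (x, y))%E.
Proof.
rewrite [RHS]integral_mkcond -GE -fubini_tonelli //.
by apply: eq_integral => x _; rewrite gE -integral_mkcond.
Qed.

End Tonelli.

(* For [a] in ]0, 1], [c <= s w a] iff [a <= q] or [c <= s w q] for every
   rational [q] in ]0, 1]: a countable intersection of unions of rectangles. *)
Lemma measurable_fun_left_antitone (R : realType) (d : measure_display)
    (T : measurableType d) (s : T -> R -> R) :
  (forall w a b, 0 < a -> a <= b -> b <= 1 -> s w b <= s w a) ->
  (forall w a x, 0 < a <= 1 -> (forall b, 0 < b < a -> x <= s w b) ->
    x <= s w a) ->
  (forall a, 0 < a <= 1 -> measurable_fun setT (s^~ a)) ->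
  measurable_fun (setT `*` `]0, 1]%classic : set (T * R)) (fun z : T * R => s z.1 z.2).
Proof.
move=> anti left ms mD.
apply: (measurability _ (RGenCInfty.measurableE R)) => // _ [_ [c ->] <-].
pose B (q : rat) : set (T * R) := if 0 < (ratr q : R) <= 1 then
  ([set w | c <= s w (ratr q)] `*` setT) `|` (setT `*` `]-oo, ratr q]%classic)
  else setT.
rewrite [X in measurable X](_ : _ =
    (setT `*` `]0, 1]%classic) `&` \bigcap_(q : rat) B q).
  apply: measurableI => //; rewrite -[X in measurable X]setCK setC_bigcap.
  apply/measurableC/bigcupT_measurable_rat => q; apply: measurableC; rewrite /B.
  case: ifP => // q01; apply: measurableU; apply: measurableX => //.
  by apply: measurable_le_set; [exact: measurable_cst | exact: ms].
apply/seteqP; split => -[w a] [[_ /=]]; rewrite in_itv /= => /andP[a0 a1].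
  rewrite in_itv /= andbT => ca; split; first by split => //; rewrite /= a0.
  move=> q _; rewrite /B; case: ifP => // /andP[q0 q1].
  have [aq|/ltW qa] := leP a (ratr q); first by right; split => //; rewrite /= in_itv.
  by left; split => //=; apply: le_trans ca _; exact: anti.
move=> H; split; first by split => //; rewrite /= a0.
rewrite /= in_itv /= andbT; apply: left; first by rewrite a0.
move=> b /andP[b0 ba]; have [q] := rat_in_itvoo ba.
rewrite in_itv /= => /andP[bq qa].
have q0 : 0 < ratr q :> R by exact: lt_trans bq.
have := H q I; rewrite /B q0 ltW /=; last exact: lt_le_trans a1.
move=> [[/= cq _]|[_ /=]]; last by rewrite in_itv /= leNgt qa.
apply: le_trans cq _; apply: anti => //; first exact: ltW.
by rewrite ltW // (lt_le_trans qa).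
Qed.

(** * Almost-everywhere arguments *)

Lemma ae_seq (R : realType) (Q : R -> Prop) (a : R) : 0 <= a <= 1 ->
  {ae (@lebesgue_measure R), forall x, `]0, 1]%classic x -> Q x} ->
  exists a_ : nat -> R, [/\ forall n, 0 < a_ n <= 1, forall n, Q (a_ n),
    (forall n, a_ n < a) \/ a = 0 & a_ n @[n --> \oo] --> a].
Proof.
move=> /andP[a0 a1] [N [mN N0 QN]].
(* An interval without points satisfying [Q] would lie in the null set [N], although its length is
   positive. *)
have QI x y : 0 <= x -> x < y -> y <= 1 -> exists2 z, x < z < y & Q z.
  move=> x0 xy y1; apply: contrapT => nQ.
  have sub : `]x, y[%classic `<=` N.
    move=> z /=; rewrite in_itv /= => /andP[xz zy]; apply: QN => /= H.
    apply: nQ; exists z; first by rewrite xz.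
    apply: H => //=; rewrite in_itv /= (le_lt_trans x0 xz) /=.
    by rewrite ltW // (lt_le_trans zy).
  have : (lebesgue_measure `]x, y[%classic <= lebesgue_measure N)%E.
    by apply: le_measure; rewrite ?inE.
  rewrite N0 lebesgue_measure_itv /= lte_fin xy -EFinB lee_fin.
  by rewrite subr_le0 leNgt xy.
have hh n : 0 < harmonic n :> R by rewrite invr_gt0.
have hh1 n : harmonic n <= 1 :> R by rewrite invf_le1 // ler1n.
have [aE|an0] := eqVneq a 0.
  have /choice[a_ a_P] : forall n, exists z, 0 < z < harmonic n /\ Q z.
    by move=> n; have [z ? ?] := QI 0 (harmonic n) (lexx _) (hh n) (hh1 n); exists z.
  exists a_; split; [| by move=> n; case: (a_P n) | by right |].
    by move=> n; have [/andP[-> /ltW h] _] := a_P n; exact: le_trans (hh1 n).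
  rewrite aE; apply: (@squeeze_cvgr _ _ _ _ (fun=> 0) harmonic).
  - by apply: nearW => n; have [/andP[/ltW -> /ltW ->] _] := a_P n.
  - exact: cvg_cst.
  - exact: cvg_harmonic.
have {an0} ap : 0 < a by rewrite lt_neqAle eq_sym an0.
(* The left end is [a] times [1 - harmonic n], which is never negative, so the interval stays inside
   the unit interval. *)
have /choice[a_ a_P] : forall n, exists z, a + - a * harmonic n < z < a /\ Q z.
  move=> n; have h := hh n; have h1 := hh1 n.
  by have [| | |z ? ?] := QI (a + - a * harmonic n) a; [nra | nra | | exists z].
exists a_; split; [| by move=> n; case: (a_P n) |
    by left => n; have [/andP[]] := a_P n|].
  move=> n; have [/andP[h1 h2] _] := a_P n; have h3 := hh n; have h4 := hh1 n.
  by apply/andP; split; nra.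
apply: (@squeeze_cvgr _ _ _ _ (fun n => a + - a * harmonic n) (fun=> a)).
- by apply: nearW => n; have [/andP[/ltW -> /ltW ->] _] := a_P n.
- exact: cvg_affine_harmonic.
- exact: cvg_cst.
Qed.

(** The difference [f - g] is non-negative with integral at most 0. Integrability of [f] comes from
    the comparison of integrals, and finiteness of [g] makes the subtraction legitimate. *)
Lemma ae_eq_of_integral_le (R : realType) (d : measure_display)
    (T : measurableType d) (mu : measure T R) (D : set T) (f g : T -> \bar R) :
  measurable D -> measurable_fun D f -> mu.-integrable D g ->
  (forall x, D x -> g x \is a fin_num) ->
  (forall x, D x -> (0 <= g x <= f x)%E) ->
  (\int[mu]_(x in D) f x <= \int[mu]_(x in D) g x)%E ->
  {ae mu, forall x, D x -> f x = g x}.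
Proof.
move=> mD mf ig gfin gf fg.
have lgf x : D x -> (g x <= f x)%E by case/gf/andP.
have f0 x : D x -> (0 <= f x)%E.
  by move=> Dx; apply: le_trans (lgf _ Dx); case/andP: (gf _ Dx).
have Ig : (\int[mu]_(x in D) g x)%E \is a fin_num by exact: integrable_fin_num.
have if_ : mu.-integrable D f.
  apply/integrableP; split => //.
  rewrite (eq_integral f); last by move=> x; rewrite inE => /f0 /gee0_abs.
  by apply: le_lt_trans fg _; rewrite ltey_eq Ig.
have mg := measurable_int _ ig.
have mfg : measurable_fun D (f \- g)%E by exact: emeasurable_funB.
have : (\int[mu]_(x in D) `|(f \- g) x| = 0)%E.
  apply/eqP; rewrite eq_le; apply/andP; split; last exact: integral_ge0.
  rewrite (eq_integral (f \- g)%E); last first.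
    by move=> x; rewrite inE => Dx; rewrite gee0_abs // sube_ge0 ?lgf // gfin.
  by rewrite integralB // sube_le0.
move/(ae_eq_integral_abs mu mD mfg).1; apply: filterS => x /[swap] Dx /(_ Dx) /=.
by move=> fg0; rewrite -[LHS](@subeK _ _ (g x)) ?gfin // fg0 add0e.
Qed.

(** * Fuzzy random variables: expected distance and fuzzy medians *)

Section FuzzyRandomVariable.
Context {R : realType} {d : measure_display} {T : measurableType d}.
Variables (P : probability T R) (X : T -> R -> R).
Hypothesis HX : fuzzy_rv X.

(** The support is at least [c] exactly when the level meets the image under [u] of the half-line
    from [c]. Random compact sets are tested on compact sets, so the half-line is exhausted by the
    segments behind [K n]. *)
Lemma measurable_supp_fun u a : u = -1 \/ u = 1 -> 0 <= a <= 1 ->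
  measurable_fun setT (fun w => supp_fun (X w) u a).
Proof.
move=> hu a01 mT; apply: (measurability _ (RGenCInfty.measurableE R)) => // _ [_ [c ->] <-].
have uu : u * u = 1 by case: hu => ->; ring.
pose K n : set R := ( *%R u) @` `[c, c + n%:R]%classic.
rewrite [X in measurable X](_ : _ = \bigcup_n [set w | level (X w) a `&` K n !=set0]).
  apply: bigcupT_measurable => n; apply: (HX.2 a a01).2.
  apply: continuous_compact; last exact: segment_compact.
  by apply: continuous_subspaceT => z; exact: mulrl_continuous.
apply/seteqP; split => w /=.
  move=> [_]; rewrite in_itv /= andbT => cs.
  have [[v lv vE] _] := supp_funP _ (X w) u a (HX.1 w) hu a01.
  exists (Num.bound (u * v - c)) => //; exists v; split => //.
  exists (u * v) => /=; last by rewrite mulrA uu mul1r.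
  have := archi_boundP (x := u * v - c); rewrite in_itv /= vE cs subr_ge0 => /(_ cs).
  by move=> /ltW; rewrite lerBlDl.
move=> [n _ [v [lv [z /=]]]]; rewrite in_itv /= => /andP[cz _] zv.
split => //; rewrite in_itv /= andbT.
have [_ ub] := supp_funP _ (X w) u a (HX.1 w) hu a01.
by apply: le_trans (ub _ lv); rewrite -zv mulrA uu mul1r.
Qed.

(** Level 0 is excluded because joint measurability rests on left continuity, available on ]0, 1];
    the removed point is Lebesgue-null. *)
Local Notation D := (`]0, 1]%classic : set R).

Lemma D01 a : D a -> 0 <= a <= 1.
Proof. by rewrite /= in_itv /= => /andP[/ltW -> ->]. Qed.

Definition supp_dist V u (z : T * R) : \bar R :=
  `|supp_fun V u z.2 - supp_fun (X z.1) u z.2|%:E.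

Lemma measurable_supp_dist V u : Fc V -> u = -1 \/ u = 1 ->
  measurable_fun (setT `*` D : set (T * R)) (supp_dist V u).
Proof.
move=> FV hu; apply/measurable_EFinP; apply: measurableT_comp => //.
(* Stated for a family [Z] so as to cover both [X] and the constant family [V]. *)
have F (Z : T -> R -> R) : (forall w, Fc (Z w)) ->
    (forall a, 0 < a <= 1 -> measurable_fun setT (fun w => supp_fun (Z w) u a)) ->
    measurable_fun (setT `*` D : set (T * R)) (fun z : T * R => supp_fun (Z z.1) u z.2).
  move=> FZ mZ; apply: (measurable_fun_left_antitone _ _ _ (fun w => supp_fun (Z w) u)) => //.
  - by move=> w a b /ltW *; exact: supp_fun_anti.
  - by move=> w a x *; exact: supp_fun_left.
apply: measurable_funB.
  by apply: (F (fun=> V)) => // a _; exact: measurable_cst.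
apply: F => [w|a /andP[/ltW a0 a1]]; first exact: HX.1.
by apply: measurable_supp_fun => //; rewrite a0.
Qed.

Definition supp_dev V u a : \bar R :=
  (\int[P]_w `|supp_fun V u a - supp_fun (X w) u a|%:E)%E.

Definition total_supp_dev V : \bar R :=
  (\int[@lebesgue_measure R]_(a in D) (supp_dev V 1 a + supp_dev V (-1) a))%E.

Lemma supp_dev_ge0 V u a : (0 <= supp_dev V u a)%E.
Proof. exact: integral_ge0. Qed.

Lemma measurable_supp_dev V u : Fc V -> u = -1 \/ u = 1 -> measurable_fun D (supp_dev V u).
Proof.
move=> FV hu; have mD : measurable D by exact: measurable_itv.
apply: (measurable_fun_tonelli_in2 P D _ mD (measurable_supp_dist V u FV hu)).
by move=> z; rewrite lee_fin.
Qed.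

Lemma integral_rho1 V : Fc V ->
  (\int[P]_w rho1 V (X w) = total_supp_dev V * (2^-1)%:E)%E.
Proof.
move=> FV; have h1 : (1 : R) = -1 \/ (1 : R) = 1 by right.
have hN : (-1 : R) = -1 \/ (-1 : R) = 1 by left.
pose f := supp_dist V.
have mf u : u = -1 \/ u = 1 -> measurable_fun (setT `*` D : set (T * R)) (f u).
  exact: measurable_supp_dist.
have f0 u z : (0 <= f u z)%E by rewrite lee_fin.
have mD : measurable D by exact: measurable_itv.
have E w : rho1 V (X w) = ((\int[@lebesgue_measure R]_(a in D) f 1%R (w, a) +
     \int[@lebesgue_measure R]_(a in D) f (-1)%R (w, a)) * (2^-1)%:E)%E.
  have m1 u : u = -1 \/ u = 1 -> measurable_fun D (fun a => f u (w, a)).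
    move=> hu; apply: (measurable_comp _ _ (mf u hu) (measurable_funTS (pair1_measurable w))).
      exact: measurableX.
    by move=> _ [a Da <-].
  (* Dropping the endpoint 0 does not change the integral. *)
  by rewrite /rho1 -!integral_itv_obnd_cbnd //; exact: m1.
have mi u : u = -1 \/ u = 1 -> measurable_fun setT
    (fun w => \int[@lebesgue_measure R]_(a in D) f u (w, a))%E.
  move=> hu; have h := measurable_fun_tonelli_in1
    (@lebesgue_measure R) D _ mD (mf u hu) (f0 u).
  exact: h.
under eq_integral do rewrite E.
have i0 u w : (0 <= \int[@lebesgue_measure R]_(a in D) f u (w, a))%E.
  exact: integral_ge0.
rewrite ge0_integralZr //; last 2 first.
- by apply: emeasurable_funD; exact: mi.
- by move=> w _; exact: adde_ge0.
rewrite ge0_integralD //; [|exact: mi|exact: mi].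
congr (_ * _)%E; rewrite /total_supp_dev [RHS]ge0_integralD //; last 4 first.
- by move=> *; exact: supp_dev_ge0.
- exact: measurable_supp_dev.
- by move=> *; exact: supp_dev_ge0.
- exact: measurable_supp_dev.
by congr (_ + _)%E; apply: fubini_tonelli_in => //; exact: mf.
Qed.

Hypothesis HN : (\int[P]_w (norm0 X w)%:E < +oo)%E.

(** Triangle inequality and domination by level 0. The bound is independent of [a], so it also
    yields integrability over [D]. *)
Lemma supp_dev_le V u a : Fc V -> u = -1 \/ u = 1 -> 0 <= a <= 1 ->
  (supp_dev V u a <= (Num.max (supp_fun V 1 0) (supp_fun V (-1) 0))%:E +
    \int[P]_w (norm0 X w)%:E)%E.
Proof.
move=> FV hu a01; have h1 : (1 : R) = -1 \/ (1 : R) = 1 by right.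
have hN : (-1 : R) = -1 \/ (-1 : R) = 1 by left.
have h01 : 0 <= (0 : R) <= 1 by rewrite lexx ler01.
set c := Num.max _ _.
have NE w : norm0 X w = Num.max (supp_fun (X w) 1 0) (supp_fun (X w) (-1) 0).
  by apply: sup_norm_level0; exact: HX.1.
have leX w : `|supp_fun (X w) u a| <= norm0 X w.
  by rewrite NE; apply: normr_supp_fun => //; exact: HX.1.
have leV : `|supp_fun V u a| <= c by exact: normr_supp_fun.
have c0 : 0 <= c by exact: le_trans leV.
have mN : measurable_fun setT (fun w => (norm0 X w)%:E).
  apply/measurable_EFinP; rewrite (funext NE).
  by apply: measurable_maxr; exact: measurable_supp_fun.
have -> : (c%:E + \int[P]_w (norm0 X w)%:E = \int[P]_w (c%:E + (norm0 X w)%:E))%E.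
  rewrite ge0_integralD //; last by move=> w _; rewrite lee_fin; exact: le_trans (leX w).
  by rewrite integral_cst //= probability_setT mule1.
apply: ge0_le_integral => //.
- by apply: measurable_dev; exact: measurable_supp_fun.
- by apply: emeasurable_funD => //; exact: measurable_cst.
- by move=> w _; rewrite -EFinD lee_fin (le_trans (ler_normB _ _)) // lerD.
Qed.

(** At each level [W] minimizes both deviations. The comparison of totals therefore forces equality
    of the sums almost everywhere, and then of each summand. *)
Lemma ae_Med V W : Fc V -> Fc W ->
  (forall u a, u = -1 \/ u = 1 -> D a ->
    Med P (fun w => supp_fun (X w) u a) (supp_fun W u a)) ->
  (total_supp_dev V <= total_supp_dev W)%E ->
  {ae @lebesgue_measure R, forall a, D a -> forall u, u = -1 \/ u = 1 ->
    Med P (fun w => supp_fun (X w) u a) (supp_fun V u a)}.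
Proof.
move=> FV FW MW VW; have h1 : (1 : R) = -1 \/ (1 : R) = 1 by right.
have hN : (-1 : R) = -1 \/ (-1 : R) = 1 by left.
have mD : measurable D by exact: measurable_itv.
have le u a : u = -1 \/ u = 1 -> D a -> (supp_dev W u a <= supp_dev V u a)%E.
  move=> hu Da; apply: Med_dev_le; last exact: MW.
  by apply: measurable_supp_fun => //; exact: D01.
pose c := (Num.max (supp_fun W 1 0) (supp_fun W (-1) 0))%:E.
pose M := (c + \int[P]_w (norm0 X w)%:E)%E.
have Mlt : (M < +oo)%E by rewrite /M lte_add_pinfty // ltry.
have leM u a : u = -1 \/ u = 1 -> D a -> (supp_dev W u a <= M)%E.
  by move=> hu /D01; exact: supp_dev_le.
have fin u a : u = -1 \/ u = 1 -> D a -> supp_dev W u a \is a fin_num.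
  by move=> hu Da; rewrite ge0_fin_numE ?supp_dev_ge0 // (le_lt_trans (leM u a hu Da)).
have mdev Z : Fc Z -> measurable_fun D (fun a => supp_dev Z 1 a + supp_dev Z (-1) a)%E.
  by move=> FZ; apply: emeasurable_funD; exact: measurable_supp_dev.
have M0 : (0 <= M)%E.
  have D1 : D 1 by rewrite /= in_itv /= ltr01 lexx.
  by apply: le_trans (leM 1 1 h1 D1); exact: supp_dev_ge0.
have Mfin : M \is a fin_num by rewrite ge0_fin_numE.
have iW : (@lebesgue_measure R).-integrable D (fun a => supp_dev W 1 a + supp_dev W (-1) a)%E.
  apply: (@le_integrable _ _ _ _ _ _ _ (cst ((fine M + fine M)%:E))) => //.
  - exact: mdev.
  - move=> a Da; rewrite gee0_abs; last by apply: adde_ge0; exact: supp_dev_ge0.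
    rewrite gee0_abs /=.
      by rewrite EFinD fineK // leeD // leM.
    by rewrite lee_fin addr_ge0 // fine_ge0.
  - apply/integrableP; split; first exact: measurable_cst.
    rewrite integral_cst //= lebesgue_measure_itv /= lte_fin ltr01 -EFinB.
    by rewrite -EFinM ltry.
have finW a : D a -> (supp_dev W 1 a + supp_dev W (-1) a)%E \is a fin_num.
  by move=> Da; rewrite fin_numD !fin.
have WV a : D a -> (0 <= supp_dev W 1 a + supp_dev W (-1) a <=
    supp_dev V 1 a + supp_dev V (-1) a)%E.
  move=> Da; apply/andP; split; first by apply: adde_ge0; exact: supp_dev_ge0.
  by apply: leeD; exact: le.
have := ae_eq_of_integral_le _ _ _ (@lebesgue_measure R) D _ _ mD (mdev V FV) iW finW WV VW.
apply: filterS => a + Da => /(_ Da) E u hu.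
have le1 := le 1 a h1 Da; have leN := le (-1) a hN Da.
have f1 := fin 1 a h1 Da; have fN := fin (-1) a hN Da.
(* Bound the summand of the other sign below by that of [W], then cancel this finite quantity. *)
have V1 : (supp_dev V u a <= supp_dev W u a)%E.
  have eqD : (supp_dev V 1 a + supp_dev V (-1) a <=
      supp_dev W 1 a + supp_dev W (-1) a)%E by rewrite E.
  case: hu => ->.
    by rewrite -(leeD2lE _ _ f1); apply: le_trans eqD; rewrite leeD2r.
  by rewrite -(leeD2rE _ _ fN); apply: le_trans eqD; rewrite leeD2l.
apply: (Med_of_dev_le _ _ _ _ _ (MW u a hu Da)) V1.
  by apply: measurable_supp_fun => //; exact: D01.
by have := fin u a hu Da; rewrite ge0_fin_numE ?supp_dev_ge0.
Qed.

Lemma Meds_of_ae V : Fc V ->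
  {ae @lebesgue_measure R, forall a, D a -> forall u, u = -1 \/ u = 1 ->
    Med P (fun w => supp_fun (X w) u a) (supp_fun V u a)} ->
  Meds P X V.
Proof.
move=> FV H; split => // u a hu a01.
have [a_ [a_01 Qa a_a cva]] := ae_seq _ _ _ a01 H.
have a_01' n : 0 <= a_ n <= 1 by have /andP[/ltW -> ->] := a_01 n.
apply: (Med_cvg P (fun n w => supp_fun (X w) u (a_ n)) _ (fun n => supp_fun V u (a_ n))).
- by move=> n; exact: measurable_supp_fun.
- exact: measurable_supp_fun.
- by move=> w; apply: supp_fun_cvg => //; exact: HX.1.
- exact: supp_fun_cvg.
- by move=> n; exact: Qa.
Qed.

(** Upper medians are chosen because their order characterization yields the monotonicity, left
    continuity and sign condition required of a support function. *)
Lemma exists_fuzzy_upper_median : exists W, Fc W /\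
  forall u a, u = -1 \/ u = 1 -> D a ->
    Med P (fun w => supp_fun (X w) u a) (supp_fun W u a).
Proof.
have h1 : (1 : R) = -1 \/ (1 : R) = 1 by right.
have hN : (-1 : R) = -1 \/ (-1 : R) = 1 by left.
have /choice[g gP] : forall z : R * R, exists g,
    (z.1 = -1 \/ z.1 = 1) -> 0 <= z.2 <= 1 ->
    Med P (fun w => supp_fun (X w) z.1 z.2) g /\
    forall x, ((2^-1)%:E <= P [set w | (x <= supp_fun (X w) z.1 z.2)%R])%E <-> x <= g.
  move=> z; have [hz|nz] := pselect ((z.1 = -1 \/ z.1 = 1) /\ 0 <= z.2 <= 1).
    have [g gP] := upper_median P _ (measurable_supp_fun _ _ hz.1 hz.2).
    by exists g.
  by exists 0 => ? ?; exfalso; apply: nz.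
have ms := measurable_supp_fun.
have mge u a x : u = -1 \/ u = 1 -> 0 <= a <= 1 ->
    measurable [set w | x <= supp_fun (X w) u a].
  by move=> hu a01; apply: measurable_le_set; [exact: measurable_cst | exact: ms].
have [| | |W [FW WE]] := @Fc_of_supp_fun R (fun u a => g (u, a)).
- move=> u a b hu a0 ab b1.
  have b01 : 0 <= b <= 1 by rewrite (le_trans a0).
  have a01 : 0 <= a <= 1 by rewrite a0 (le_trans ab).
  apply/((gP (u, a) hu a01).2 _).1; apply: le_trans (((gP (u, b) hu b01).2 _).2 (lexx _)) _.
  apply: le_measure; rewrite ?inE; [exact: mge|exact: mge|].
  by move=> w /= /le_trans; apply; apply: supp_fun_anti => //; exact: HX.1.
- move=> u a x hu a01 H.
  have [a0 a1] := andP a01; have a01' : 0 <= a <= 1 by rewrite ltW.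
  apply/((gP (u, a) hu a01').2 _).1.
  (* The factor 1/2 keeps the sequence at or above [a / 2], hence positive. *)
  pose a_ n : R := a + (- a / 2) * harmonic n.
  have a_P n : 0 < a_ n < a.
    have h0 : 0 < harmonic n :> R by rewrite invr_gt0.
    have hh1 : harmonic n <= 1 :> R by rewrite invf_le1 // ler1n.
    by rewrite /a_; apply/andP; split; nra.
  have a_01 n : 0 < a_ n <= 1.
    by have /andP[-> /ltW h] := a_P n; exact: le_trans a1.
  have a_01' n : 0 <= a_ n <= 1 by have /andP[/ltW -> ->] := a_01 n.
  apply: (probability_ge_cvg P _ (fun n w => supp_fun (X w) u (a_ n)) _ (fun=> x)).
  + by move=> n; exact: ms.
  + exact: ms.
  + move=> w; apply: supp_fun_cvg => //; first exact: HX.1.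
      by left => n; case/andP: (a_P n).
    exact: cvg_affine_harmonic.
  + exact: cvg_cst.
  + by move=> n; apply/((gP (u, a_ n) hu (a_01' n)).2 _).2; exact: H.
- move=> a /andP[/ltW a0 a1]; have a01 : 0 <= a <= 1 by rewrite a0.
  rewrite leNgt; apply/negP => gneg.
  (* If the sum were negative, [c] would lie strictly between [g (1, a)] and [- g (-1, a)]. Every
     level is non-empty, so the events [c <= supp_fun (X w) 1 a] and [- c <= supp_fun (X w) (-1) a]
     cover the space and cannot both have probability below 1/2. *)
  pose c := (g (1, a) - g (-1, a)) / 2.
  have nc1 : ~ c <= g (1, a) by rewrite /c => ?; lra.
  have ncN : ~ - c <= g (-1, a) by rewrite /c => ?; lra.
  apply: ncN; apply/((gP (-1, a) hN a01).2 _).1 => /=; apply/ltW.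
  apply: (half_lt_of_cover _ [set w | c <= supp_fun (X w) 1 a]); [exact: mge|exact: mge| |].
    apply/seteqP; split => // w _ /=.
    have [[v lv vE] ub1] := supp_funP _ _ 1 a (HX.1 w) h1 a01.
    have [_ ubN] := supp_funP _ _ (-1) a (HX.1 w) hN a01.
    have := ubN _ lv; have [cs|cs] := leP c (supp_fun (X w) 1 a); first by left.
    by rewrite -vE in cs => ?; right; lra.
  by apply/negP => /((gP (1, a) h1 a01).2 _).1.
exists W; split => // u a hu Da.
by rewrite WE //; have [] := gP (u, a) hu (D01 a Da).
Qed.

End FuzzyRandomVariable.

Theorem theorem4p2 (R : realType) (d : measure_display) (T : measurableType d)
  (P : probability T R) (X : T -> R -> R) :
  fuzzy_rv X ->
  (\int[P]_w (norm0 X w)%:E < +oo)%E ->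
  Med1 P X = Meds P X.
Proof.
move=> HX HN; have half0 : 0 < (2^-1 : R) by [].
apply/seteqP; split => U [FU UP].
  have [W [FW MW]] := exists_fuzzy_upper_median P X HX.
  apply: (Meds_of_ae P X HX U FU).
  apply: (ae_Med P X HX HN U W FU FW MW).
  have := UP W FW; rewrite (integral_rho1 P X HX U FU) (integral_rho1 P X HX W FW).
  by rewrite lee_pmul2r // lte_fin.
split=> [|V FV]; first exact: FU.
rewrite (integral_rho1 P X HX U FU) (integral_rho1 P X HX V FV).
apply: lee_wpmul2r; first by rewrite lee_fin ltW.
have m Z : Fc Z -> measurable_fun (`]0, 1]%classic : set R)
    (fun a => supp_dev P X Z 1 a + supp_dev P X Z (-1) a)%E.
  move=> FZ; apply: emeasurable_funD.
    by apply: measurable_supp_dev => //; right.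
  by apply: measurable_supp_dev => //; left.
apply: ge0_le_integral.
- exact: measurable_itv.
- by move=> *; apply: adde_ge0; exact: supp_dev_ge0.
- exact: m.
- exact: m.
- move=> a Da; have a01 := D01 a Da.
  have le u : u = -1 \/ u = 1 -> (supp_dev P X U u a <= supp_dev P X V u a)%E.
    move=> hu; apply: Med_dev_le; last exact: UP.
    exact: measurable_supp_fun.
  by apply: leeD; apply: le; [right|left].
Qed.
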